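(* If $A$ is $\Delta$-normal for some regular triangulation $\Delta$ of $\mathrm{cone}(A)$, then there exists a generic cost vector $c\in\mathbb{Z}^n$ such that $\Delta=\Delta_c$ and $IP_{A,c}$ is a Gomory family.
   Context: $\mathbb{N}$ denotes the non-negative integers. $A \in \mathbb{Z}^{d\times n}$ is a matrix of rank $d$ with columns $a_1,\dots,a_n$; $\mathrm{cone}(A)=\{Au : u\in\mathbb{R}^n, u\ge 0\}$ is pointed and $\{u\in\mathbb{R}^n: Au=0, u\ge 0\}=\{0\}$; $\mathbb{N}A=\{Au: u\in\mathbb{N}^n\}$. For $b\in\mathbb{N}A$ and a cost vector $c$, $IP_{A,c}(b)$ is the program $\min\{c\cdot x: Ax=b, x\in\mathbb{N}^n\}$; $IP_{A,c}$ is the family of these programs. $c$ is generic if each $IP_{A,c}(b)$, $b\in\mathbb{N}A$, has a unique optimal solution. For $\sigma\subseteq\{1,\dots,n\}$, $\bar\sigma$ is the complement, $A_\sigma$ the submatrix of columns indexed by $\sigma$, $x_\sigma$ the subvector indexed by $\sigma$. For generic $c$, $\Delta_c$ is the set of all $\sigma\subseteq\{1,\dots,n\}$ for which there is $y\in\mathbb{R}^d$ with $y\cdot a_j=c_j$ for $j\in\sigma$ and $y\cdot a_j<c_j$ for $j\notin\sigma$; its elements are called faces, and the cones $\mathrm{cone}(A_\sigma)$, $\sigma\in\Delta_c$, form a triangulation of $\mathrm{cone}(A)$ (a complex of simplicial cones with support $\mathrm{cone}(A)$, whose maximal faces have $d$ elements). A regular triangulation of $\mathrm{cone}(A)$ is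 one of the form $\Delta_{c'}$ for a generic cost vector $c'$. $A$ is $\Delta$-normal if for every maximal face $\sigma\in\Delta$, the columns of $A$ lying in $\mathrm{cone}(A_\sigma)$ form a Hilbert basis of $\mathrm{cone}(A_\sigma)$, i.e. every point of $\mathrm{cone}(A_\sigma)\cap\mathbb{Z}^d$ is a non-negative integer combination of these columns. Group relaxation: for a maximal face $\sigma$ of $\Delta_c$ and $b\in\mathbb{N}A$, $G^\sigma(b)$ is the program $\min\{(c_{\bar\sigma}-c_\sigma A_\sigma^{-1}A_{\bar\sigma})\cdot x_{\bar\sigma}: A_\sigma x_\sigma+A_{\bar\sigma}x_{\bar\sigma}=b,\ x_{\bar\sigma}\ge 0,\ (x_\sigma,x_{\bar\sigma})\in\mathbb{Z}^n\}$; it solves $IP_{A,c}(b)$ if its (unique) optimal solution is non-negative. $IP_{A,c}$ is a Gomory family if for every $b\in\mathbb{N}A$, $IP_{A,c}(b)$ is solved by $G^\sigma(b)$ for some maximal face $\sigma$ of $\Delta_c$. *)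

(* Defs.v *)
From HB Require Import structures.
From mathcomp Require Import all_boot all_order all_algebra.
From mathcomp Require Import classical_sets reals.

Set Implicit Arguments.
Unset Strict Implicit.
Unset Printing Implicit Defensive.

Import Order.TTheory GRing.Theory Num.Theory.
Local Open Scope classical_set_scope.
Local Open Scope ring_scope.

(* [M_s] and [x_s] for an index set [s], listed in increasing order. *)
Definition csub (T : Type) (m n : nat) (s : {set 'I_n}) (M : 'M[T]_(m, n)) :
    'M[T]_(m, #|s|) :=
  colsub (fun i : 'I_#|s| => enum_val i) M.

Definition rsub (T : Type) (m n : nat) (s : {set 'I_n}) (M : 'M[T]_(n, m)) :
    'M[T]_(#|s|, m) :=
  rowsub (fun i : 'I_#|s| => enum_val i) M.

Definition toR (R : realType) (m n : nat) (M : 'M[int]_(m, n)) : 'M[R]_(m, n) :=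
  map_mx intr M.
Arguments toR R {m n} M.

Definition cone (R : realType) (m k : nat) (M : 'M[R]_(m, k)) : set 'cV[R]_m :=
  [set v | exists2 u : 'cV[R]_k, u \is a mxOver Num.nneg & v = M *m u].

Definition pointed (R : realType) (m : nat) (C : set 'cV[R]_m) : Prop :=
  forall v, C v -> C (- v) -> v = 0.

Definition semigroup (d n : nat) (A : 'M[int]_(d, n)) : set 'cV[int]_d :=
  [set b | exists2 u : 'cV[int]_n, u \is a mxOver Num.nneg & b = A *m u].

Section Programs.
Context (R : realType) (d n : nat) (A : 'M[int]_(d, n)).
Implicit Types (c : 'rV[R]_n) (b : 'cV[int]_d) (x : 'cV[int]_n).
Implicit Types (s : {set 'I_n}) (D : set {set 'I_n}).

Definition cost (k : nat) (w : 'rV[R]_k) (x : 'cV[int]_k) : R :=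
  (w *m toR R x) 0 0.

Definition IP_feasible b : set 'cV[int]_n :=
  [set x | A *m x = b /\ x \is a mxOver Num.nneg].

Definition IP_optimal c b : set 'cV[int]_n :=
  [set x | IP_feasible b x /\
           forall x', IP_feasible b x' -> cost c x <= cost c x'].

Definition generic c : Prop :=
  forall b, semigroup A b -> exists! x, IP_optimal c b x.

Definition Delta c : set {set 'I_n} :=
  [set s | exists y : 'rV[R]_d,
      (forall j, j \in s -> (y *m toR R A) 0 j = c 0 j) /\
      (forall j, j \notin s -> (y *m toR R A) 0 j < c 0 j)].

Definition maximal_face D s : Prop :=
  D s /\ forall t, D t -> s \subset t -> t = s.

Definition regular_triangulation D : Prop :=
  exists2 c, generic c & D = Delta c.

Definition Delta_normal D : Prop :=
  forall s, maximal_face D s ->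
  forall z : 'cV[int]_d, cone (csub s (toR R A)) (toR R z) ->
  exists u : 'cV[int]_n,
    [/\ u \is a mxOver Num.nneg,
        forall j, u j 0 != 0 -> cone (csub s (toR R A)) (toR R (col j A))
      & z = A *m u].

(* For generic [c] and [s] a maximal face, [A_s] is square and invertible, but
   its width [#|s|] is not syntactically [d]: [pinvmx] is its inverse without a
   cast, see [pinvmx_inverse] below. *)
Definition reduced_cost c s : 'rV[R]_#|~: s| :=
  csub (~: s) c
  - csub s c *m pinvmx (csub s (toR R A)) *m csub (~: s) (toR R A).

Definition G_feasible s b : set 'cV[int]_n :=
  [set x | csub s A *m rsub s x + csub (~: s) A *m rsub (~: s) x = b /\
           rsub (~: s) x \is a mxOver Num.nneg].

Definition G_optimal c s b : set 'cV[int]_n :=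
  [set x | G_feasible s b x /\
     forall x', G_feasible s b x' ->
       cost (reduced_cost c s) (rsub (~: s) x)
         <= cost (reduced_cost c s) (rsub (~: s) x')].

Definition G_solves_IP c s b : Prop :=
  exists2 x, unique (G_optimal c s b) x & x \is a mxOver Num.nneg.

Definition Gomory_family c : Prop :=
  forall b, semigroup A b ->
  exists2 s, maximal_face (Delta c) s & G_solves_IP c s b.

End Programs.

Lemma pinvmx_inverse (F : fieldType) (d k : nat) (M : 'M[F]_(d, k)) :
  k = d -> row_free M -> M *m pinvmx M = 1%:M /\ pinvmx M *m M = 1%:M.
Proof.
move=> kd; move: M; rewrite kd => M; rewrite row_free_unit => uM.
by rewrite pinvmxE // mulmxV // mulVmx.
Qed.

(* Main.v *)
Require Import Defs.
From HB Require Import structures.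
From mathcomp Require Import all_boot all_order all_algebra.
From mathcomp Require Import classical_sets reals boolp.
From mathcomp Require Import lra.

Set Implicit Arguments.
Unset Strict Implicit.
Unset Printing Implicit Defensive.

Import Order.TTheory GRing.Theory Num.Theory.
Local Open Scope classical_set_scope.
Local Open Scope ring_scope.

(** Let [w] be a cost vector with [D = Delta A w]; adding [y *m A] for a
functional [y] that is positive on every column changes neither [D] nor the
reduced costs, so [w] may be taken positive. A maximal face [s] has [d]
linearly independent columns, hence carries a unique linear function [f_s] with
value [w_i] at the column [a_i] for [i] in [s], and [g = max_s f_s] is a convex
function that is linear exactly on the cones of [D]. The columns that belong to
no maximal face, called interior below, may have any heights above [g] without
affecting [D].

The cost vector of the theorem is close to [q_j = M * g a_j] on the columns of
the faces and [q_j = (M + 1) * g a_j] on the interior columns, with [M] large.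
For a maximal face [s], the reduced cost of a column outside [s] is then
[f_s a_j] if [a_j] lies in the cone of [s], and is huge otherwise. Let [b] lie
in the cone of [s], with coordinates [beta] in the basis [A_s]. A feasible
point [x] of the relaxation that uses only columns in the cone of [s] has
reduced cost [f_s (sum_(j notin s) x_j a_j) = sum_(i in s) w_i (beta_i - x_i)].
The numbers [beta_i - x_i] are nonnegative, being the coordinates of a point of
the cone, and they are congruent to [beta_i] modulo 1; so the reduced cost is at
least [F = sum_i w_i frac(beta_i)], and at least [F + w_k] if [x_k < 0]
([cheap_nonneg]). Conversely, normality expresses [sum_i frac(beta_i) a_i]
by columns in the cone, and adding [floor(beta)] gives a nonnegative
feasible point of reduced cost at most [F] ([rounded_solution]). Hence optimal
solutions of the relaxation are nonnegative.

The margin [w_k] does not depend on [b], while [F] is at most [C = sum_j w_j].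
The argument therefore survives a small relative error in the reduced costs,
which leaves room to make the cost integral and the optima unique. Optimal
solutions are bounded off [s], so two of them differ by a vector of the
kernel of [A] whose entries are below a constant [W]. The choice
[c_j = W^n floor(N q_j) + W^j] is close to [N W^n q_j], and modulo [W^n]
the cost of such a vector is a numeral with digits below [W] in absolute value,
which vanishes only if all digits do ([integral_approximation]). Finally a
unique nonnegative optimum of a relaxation is a unique optimum of the integer
program, so [c] is generic ([relaxation_generic]).

The geometry of the triangulation is linear programming: Farkas' lemma
([farkas]) makes [D] nonempty, and the dual simplex method shows that the cones
of the maximal faces cover the cone of [A] ([maximal_faces_cover]). *)

(** * Coordinates in the basis of a maximal face *)

Lemma subrmxE (V : zmodType) (p q : nat) (M N : 'M[V]_(p, q)) i j :
  (M - N) i j = M i j - N i j.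
Proof. by rewrite !mxE. Qed.

Lemma toRE (R : realType) (p q : nat) (M : 'M[int]_(p, q)) i j :
  toR R M i j = (M i j)%:~R.
Proof. by rewrite mxE. Qed.

Lemma csubE (T : pzSemiRingType) (m n : nat) (s : {set 'I_n}) (M : 'M[T]_(m, n)) :
  csub s M = M *m csub s 1%:M.
Proof. by rewrite /csub mulmx_colsub mulmx1. Qed.

Lemma csub1_notin (T : pzSemiRingType) (n : nat) (s : {set 'I_n}) i (k : 'I_#|s|) :
  i \notin s -> csub s (1%:M : 'M[T]_n) i k = 0.
Proof.
move=> is_; rewrite !mxE; case: eqP => // iE.
by move: is_; rewrite iE enum_valP.
Qed.

Lemma csub_rsub_sum (T : pzSemiRingType) (m n p : nat) (s : {set 'I_n})
    (M : 'M[T]_(m, n)) (x : 'M[T]_(n, p)) :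
  csub s M *m rsub s x + csub (~: s) M *m rsub (~: s) x = M *m x.
Proof.
apply/matrixP => i k; rewrite !mxE (bigID [in s]) /=; congr (_ + _).
  by rewrite [RHS]big_enum_val; apply: eq_bigr => j _; rewrite !mxE.
transitivity (\sum_(j in ~: s) M i j * x j k).
  by rewrite [RHS]big_enum_val; apply: eq_bigr => j _; rewrite !mxE.
by apply: eq_bigl => j; rewrite inE.
Qed.

Section Coordinates.
Context (R : realType) (d n : nat) (A : 'M[int]_(d, n)).
Notation Ar := (toR R A).
Implicit Types (s : {set 'I_n}) (c : 'rV[R]_n).

(** Coordinates of a vector in the basis [A_s], padded by zeros outside [s]:
the common index set ['I_n] lets coordinates for different faces be compared,
and [c *m coords s] is the functional with values [c_j] at the columns of [s]. *)
Definition coords s : 'M[R]_(n, d) := csub s 1%:M *m pinvmx (csub s Ar).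

Definition simplex_basis s := (#|s| == d) && row_free (csub s Ar).

Lemma coords_notin s (p : nat) (M : 'M[R]_(d, p)) i k :
  i \notin s -> (coords s *m M) i k = 0.
Proof.
move=> is_; rewrite /coords -mulmxA mxE big1 // => j _.
by rewrite csub1_notin // mul0r.
Qed.

Lemma coordsK s : simplex_basis s -> Ar *m coords s = 1%:M.
Proof. by case/andP => _ ?; rewrite /coords mulmxA -csubE mulmxVp. Qed.

Lemma coords_csub s : simplex_basis s ->
  coords s *m Ar *m csub s 1%:M = csub s 1%:M.
Proof.
case/andP => /eqP sd fs; rewrite -mulmxA -csubE /coords -mulmxA.
by have [_ ->] := pinvmx_inverse sd fs; rewrite mulmx1.
Qed.

Lemma coords_in s i j : simplex_basis s -> j \in s ->
  (coords s *m Ar) i j = (i == j)%:R.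
Proof.
move=> bs js; have /matrixP/(_ i (enum_rank_in js j)) := coords_csub bs.
by rewrite -csubE !mxE enum_rankK_in.
Qed.

Lemma coords_mul s (v : 'cV[R]_n) : simplex_basis s ->
  (forall i, i \notin s -> v i 0 = 0) -> coords s *m (Ar *m v) = v.
Proof.
move=> bs v0; apply/matrixP => i k; rewrite ord1 mulmxA mxE.
rewrite (bigID [in s]) /= [X in _ + X]big1 ?addr0; last first.
  by move=> j js; rewrite v0 // mulr0.
have [is_|is_] := boolP (i \in s).
  rewrite (bigD1 i) //= coords_in // eqxx mul1r big1 ?addr0 // => j /andP[js ji].
  by rewrite coords_in // eq_sym (negbTE ji) mul0r.
rewrite v0 // big1 // => j js; rewrite coords_in //.
by case: eqP js is_ => [->->|]; rewrite ?mul0r.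
Qed.

Lemma mul_coords s c (p : nat) (M : 'M[R]_(d, p)) k :
  (c *m (coords s *m M)) 0 k = \sum_(i in s) c 0 i * (coords s *m M) i k.
Proof.
rewrite mxE (bigID [in s]) /= [X in _ + X]big1 ?addr0 //.
by move=> j js; rewrite coords_notin // mulr0.
Qed.

Lemma price_in s c j : simplex_basis s -> j \in s ->
  (c *m coords s *m Ar) 0 j = c 0 j.
Proof.
move=> bs js; rewrite -mulmxA mul_coords (bigD1 j) //= coords_in // eqxx mulr1.
rewrite big1 ?addr0 // => i /andP[_ ij].
by rewrite coords_in // (negbTE ij) mulr0.
Qed.

Lemma price_unique s c (y : 'rV[R]_d) : simplex_basis s ->
  (forall j, j \in s -> (y *m Ar) 0 j = c 0 j) -> y = c *m coords s.
Proof.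
move=> bs yc; rewrite -[y]mulmx1 -(coordsK bs).
rewrite mulmxA -[coords s]mulmx1; apply/rowP => k.
by rewrite !mul_coords; apply: eq_bigr => i is_; rewrite yc.
Qed.

Lemma cone_coords s (z : 'cV[R]_d) : simplex_basis s ->
  cone (csub s Ar) z <-> forall i, 0 <= (coords s *m z) i 0.
Proof.
move=> bs; split.
  case=> u u0 -> i; rewrite (csubE s Ar) mulmxA (mulmxA (coords s)) coords_csub //.
  rewrite mxE sumr_ge0 // => k _; apply: mulr_ge0; last first.
    by move/mxOverP: u0 => /(_ k 0).
  by rewrite !mxE ler0n.
move=> z0; exists (pinvmx (csub s Ar) *m z).
  apply/mxOverP => k j; rewrite ord1 nnegrE.
  set w := pinvmx _ *m z; have wE : coords s *m z = csub s 1%:M *m w.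
    by rewrite mulmxA.
  have := z0 (enum_val k); rewrite wE mxE (bigD1 k) //= [X in _ + X]big1.
    by rewrite !mxE eqxx mul1r addr0.
  move=> l lk; rewrite !mxE; case: eqP => [/enum_val_inj kl|_]; rewrite ?mul0r //.
  by rewrite kl eqxx in lk.
by case/andP: bs => _ fs; rewrite mulmxA mulmxVp // mul1mx.
Qed.

Lemma toR_mul (p q r : nat) (M : 'M[int]_(p, q)) (N : 'M[int]_(q, r)) :
  toR R (M *m N) = toR R M *m toR R N.
Proof. exact: map_mxM. Qed.

(** On the points with [A x = b], the reduced cost and [c] differ by a constant,
so the group relaxation can be studied with the objective [c] itself. *)
Lemma cost_reduced s c (x : 'cV[int]_n) : simplex_basis s ->
  cost (reduced_cost A c s) (rsub (~: s) x)
    = cost c x - (c *m coords s *m toR R (A *m x)) 0 0.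
Proof.
move=> bs; set y := c *m coords s.
have rE : reduced_cost A c s = csub (~: s) (c - y *m Ar).
  rewrite /reduced_cost [in RHS]csubE mulmxBl -!csubE; congr (_ - _).
  by rewrite [csub s c]csubE [in RHS]csubE /y /coords [csub (~: s) Ar]csubE !mulmxA.
have s0 : csub s (c - y *m Ar) = 0.
  apply/rowP => k; have ks := enum_valP k.
  by rewrite !mxE -(price_in c bs ks) !mxE subrr.
rewrite /cost rE.
have -> : toR R (rsub (~: s) x) = rsub (~: s) (toR R x).
  by apply/matrixP => i j; rewrite !mxE.
have := csub_rsub_sum s (c - y *m Ar) (toR R x).
rewrite s0 mul0mx add0r => ->.
by rewrite toR_mul mulmxBl mulmxA !mxE.
Qed.

End Coordinates.

(** * Farkas' lemma and dual feasible functionals *)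

(** Induction on the number of columns. If dropping the first column [a]
breaks the hypothesis, a functional [y] witnessing this is positive at [a], and
subtracting from every functional the multiple of [y] that kills [a] reduces
the problem to the other columns. *)
Lemma farkas (R : realType) (m k : nat) (M : 'M[R]_(m, k)) (g : 'cV[R]_m) :
  (forall y : 'rV[R]_m, (forall j, (y *m M) 0 j <= 0) -> (y *m g) 0 0 <= 0) ->
  cone M g.
Proof.
elim: k M g => [|k IHk] M g Mg.
  exists 0; first by apply/mxOverP => - [].
  apply/colP => i; rewrite mulmx0 mxE; apply/eqP; rewrite eq_le.
  have h (e : R) : e * g i 0 <= 0.
    have -> : e * g i 0 = ((e *: delta_mx 0 i : 'rV_m) *m g) 0 0.
      by rewrite -scalemxAl -rowE !mxE.
    by apply: Mg; case.
  by have := h 1; have := h (-1); lra.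
rewrite -[k.+1]/(1 + k)%N in M Mg *.
have -> : M = row_mx (lsubmx M) (rsubmx M) by rewrite hsubmxK.
move: Mg; rewrite -[M in X in X -> _]hsubmxK.
set a := lsubmx M; set N := rsubmx M => Mg.
have colE (y : 'rV[R]_m) j : (y *m row_mx a N) 0 j =
    match split j with inl i => (y *m a) 0 i | inr i => (y *m N) 0 i end.
  by rewrite mul_mx_row mxE; case: split.
have [Ng|] := pselect (forall y : 'rV[R]_m,
    (forall j, (y *m N) 0 j <= 0) -> (y *m g) 0 0 <= 0).
  have [u u0 ->] := IHk _ _ Ng; exists (col_mx 0 u).
    apply/mxOverP => i j; rewrite mxE; case: split => l; rewrite ?mxE ?nnegrE //.
    exact: (mxOverP u0).
  by rewrite mul_row_col mulmx0 add0r.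
move/existsNP => [y /not_implyP [yN /negP]]; rewrite -ltNge => yg.
have ya : 0 < (y *m a) 0 0.
  rewrite ltNge; apply/negP => ya; move: yg; rewrite ltNge => /negP; apply.
  apply: Mg => j; rewrite colE; case: split => l //.
  by rewrite ord1.
pose al := (y *m a) 0 0.
(* The projection, along [y], onto the functionals that vanish at [a]. *)
pose p (x : 'rV[R]_m) := x - ((x *m a) 0 0 / al) *: y.
have pa x : (p x *m a) 0 0 = 0.
  rewrite /p mulmxBl -scalemxAl /al; move: (y *m a) ya (x *m a) => r r0 q.
  by rewrite !mxE divfK ?subrr // gt_eqF.
pose N' := N - a *m (al^-1 *: (y *m N)).
pose g' := g - a *m (al^-1 *: (y *m g)).
have pE (q : nat) (x : 'rV[R]_m) (Q : 'M[R]_(m, q)) :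
    x *m (Q - a *m (al^-1 *: (y *m Q))) = p x *m Q.
  rewrite /p mulmxBr mulmxBl; congr (_ - _).
  by rewrite mulmxA [X in X *m _ = _]mx11_scalar mul_scalar_mx -scalemxAl scalerA.
have [u u0 gu] : cone N' g'.
  apply: IHk => x xN; rewrite pE; apply: Mg => j; rewrite colE.
  case: split => l; first by rewrite ord1 pa.
  by rewrite -pE.
pose e := al^-1 *: (y *m g - y *m N *m u).
exists (col_mx e u).
  apply/mxOverP => i j; rewrite mxE; case: split => l; last exact: (mxOverP u0).
  rewrite !ord1 nnegrE; have : (y *m N *m u) 0 0 <= 0.
    rewrite mxE; apply: sumr_le0 => h _; apply: mulr_le0_ge0 => //.
    exact: (mxOverP u0).
  rewrite /e /al; move: (y *m N *m u) (y *m g) (y *m a) yg ya => p1 p2 p3 p20 p30 p10.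
  by rewrite !mxE mulr_ge0 ?invr_ge0 ?(ltW p30) // subr_ge0 (le_trans p10) ?ltW.
rewrite mul_row_col /e scalerBr mulmxBr.
move/eqP: gu; rewrite /g' /N' subr_eq mulmxBl -(mulmxA a) -scalemxAl => /eqP gE.
by rewrite [LHS]gE [RHS]addrC -addrA; congr (_ + _); rewrite addrC.
Qed.

(** Lets finitely many constants be chosen in one step. *)
Lemma large_enough (R : realType) (I : finType) (P : I -> R -> Prop) :
  (forall i, exists M, forall M', M <= M' -> P i M') ->
  exists2 M, 0 < M & forall M' i, M <= M' -> P i M'.
Proof.
move=> /choice [f Pf]; exists (1 + \sum_i `|f i|).
  by rewrite ltr_wpDr // sumr_ge0.
move=> M' i MM'; apply: Pf; apply: le_trans MM'; rewrite (bigD1 i) //=.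
have := ler_norm (f i); have : 0 <= \sum_(j | j != i) `|f j| by rewrite sumr_ge0.
by lra.
Qed.

Section Faces.
Context (R : realType) (d n : nat) (A : 'M[int]_(d, n)).
Notation Ar := (toR R A).
Implicit Types (s t : {set 'I_n}) (c : 'rV[R]_n) (y z : 'rV[R]_d).

(** A column whose opposite lay in the cone would give a nonzero nonnegative
vector of the kernel, so Farkas' lemma separates each opposite column from the
cone; the sum of the separating functionals is positive on all columns. *)
Lemma positive_functional :
  [set u : 'cV[R]_n | Ar *m u = 0 /\ u \is a mxOver Num.nneg] = [set 0] ->
  exists y, forall j, 0 < (y *m Ar) 0 j.
Proof.
move=> ker_A.
have /choice [f fP] : forall j, exists y,
    (forall k, 0 <= (y *m Ar) 0 k) /\ 0 < (y *m Ar) 0 j.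
  move=> j; apply: contrapT => nex.
  have [u u0 uE] : cone Ar (- col j Ar).
    apply: farkas => y yA; rewrite leNgt; apply/negP => yj; apply: nex.
    exists (- y); split=> [k|]; rewrite mulNmx mxE ?oppr_ge0 //.
    by move: yj; rewrite mulmxN colE mulmxA -colE !mxE.
  have : [set u : 'cV[R]_n | Ar *m u = 0 /\ u \is a mxOver Num.nneg]
           (u + delta_mx j 0).
    split; first by rewrite mulmxDr -uE colE addNr.
    apply/mxOverP => i k; rewrite !mxE nnegrE addr_ge0 ?ler0n //.
    exact: (mxOverP u0).
  rewrite ker_A => /= /colP /(_ j); rewrite !mxE !eqxx /= => e.
  by have := mxOverP u0 j 0; rewrite nnegrE; lra.
exists (\sum_j f j) => j; rewrite mulmx_suml summxE.
rewrite (bigD1 j) //= ltr_wpDr //; last by case: (fP j).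
by rewrite sumr_ge0 // => k _; case: (fP k).
Qed.

Definition dual_feasible c y := forall j, (y *m Ar) 0 j <= c 0 j.

Definition tight c y : {set 'I_n} := [set j | (y *m Ar) 0 j == c 0 j].

Lemma tight_face c y : dual_feasible c y -> Delta A c (tight c y).
Proof.
move=> yc; exists y; split=> j; rewrite inE; first by move/eqP.
by move=> ne; rewrite lt_neqAle ne yc.
Qed.

Lemma face_price c s : Delta A c s ->
  exists y, dual_feasible c y /\ tight c y = s.
Proof.
case=> y [ys yns]; exists y; split=> [j|].
  have [/ys -> //|/yns/ltW //] := boolP (j \in s).
apply/setP => j; rewrite inE; have [/ys ->|/yns/lt_eqF //] := boolP (j \in s).
by rewrite eqxx.
Qed.

Lemma ray_entry (m p : nat) (y z : 'rV[R]_m) (t : R) (M : 'M[R]_(m, p)) l :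
  ((y + t *: z) *m M) 0 l = (y *m M) 0 l + t * (z *m M) 0 l.
Proof. by rewrite mulmxDl -scalemxAl !mxE. Qed.

(** The ratio test of the simplex method. *)
Lemma ray_hit c y z j : dual_feasible c y -> 0 < (z *m Ar) 0 j ->
  (forall k, 0 < (z *m Ar) 0 k -> (y *m Ar) 0 k < c 0 k) ->
  exists2 t : R, 0 < t & dual_feasible c (y + t *: z) /\
    exists2 k, 0 < (z *m Ar) 0 k & k \in tight c (y + t *: z).
Proof.
move=> yc zj zc; pose e k := (c 0 k - (y *m Ar) 0 k) / (z *m Ar) 0 k.
have [k zk ek] := arg_minP (P := fun k => 0 < (z *m Ar) 0 k) e zj.
have ek0 : 0 < e k by rewrite divr_gt0 // subr_gt0 zc.
exists (e k) => //; split=> [l|].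
  rewrite ray_entry -lerBrDl; have [zl|zl] := ltP 0 ((z *m Ar) 0 l).
    by rewrite -ler_pdivlMr // ek.
  by rewrite (@le_trans _ _ 0) ?subr_ge0 // mulr_ge0_le0 // ltW.
exists k => //; rewrite inE ray_entry /e divfK ?(lt0r_neq0 zk) //.
by rewrite addrC subrK.
Qed.

Lemma face_sub_maximal (D : set {set 'I_n}) s : D s ->
  exists2 t, maximal_face D t & s \subset t.
Proof.
move=> Ds; have /(arg_maxnP (fun t : {set 'I_n} => #|t|)) :
  [pred t | `[< D t >] && (s \subset t)] s by rewrite /= subxx andbT; apply/asboolP.
case=> t /= /andP[/asboolP Dt st] tmax; exists t => //; split=> // t' Dt' tt'.
apply/eqP; rewrite eq_sym eqEcard tt' /=.
apply: tmax; rewrite /= (fintype.subset_trans st tt') andbT; exact/asboolP.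
Qed.
End Faces.

(** * Faces of a regular triangulation *)

Section Triangulation.
Context (R : realType) (d n : nat) (A : 'M[int]_(d, n)).
Notation Ar := (toR R A).
Implicit Types (s t : {set 'I_n}) (c : 'rV[R]_n) (y z : 'rV[R]_d).

Lemma costE (k : nat) (w : 'rV[R]_k) (x : 'cV[int]_k) :
  cost w x = \sum_j w 0 j * (x j 0)%:~R.
Proof. by rewrite /cost mxE; apply: eq_bigr => j _; rewrite mxE. Qed.

Lemma price_mulE y (x : 'cV[int]_n) :
  (y *m toR R (A *m x)) 0 0 = \sum_j (y *m Ar) 0 j * (x j 0)%:~R.
Proof. by rewrite toR_mul mulmxA -[LHS]/(cost _ _) costE. Qed.

Lemma nneg_entry (k : nat) (x : 'cV[int]_k) j :
  x \is a mxOver Num.nneg -> 0 <= ((x j 0)%:~R : R).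
Proof. by move=> x0; rewrite ler0z; exact: (mxOverP x0). Qed.

(** Complementary slackness, with the functional of the face as dual solution. *)
Lemma supported_optimal c s (x : 'cV[int]_n) : Delta A c s ->
  x \is a mxOver Num.nneg -> (forall j, j \notin s -> x j 0 = 0) ->
  IP_optimal A c (A *m x) x.
Proof.
move=> /face_price [y [yc ys]] x0 xs; split=> // x' [x'E x'0].
apply: (@le_trans _ _ ((y *m toR R (A *m x)) 0 0)).
  rewrite price_mulE costE; apply: ler_sum => j _.
  have [|/xs ->] := boolP (j \in s); last by rewrite !mulr0.
  by rewrite -ys inE => /eqP ->.
rewrite -x'E price_mulE costE; apply: ler_sum => j _.
by apply: ler_wpM2r (yc j); exact: nneg_entry.
Qed.

Lemma rat_clear_denominators (k : nat) (w : 'rV[rat]_k) :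
  exists2 N : int, N != 0 & exists v : 'rV[int]_k, map_mx intr v = N%:~R *: w.
Proof.
exists (\prod_l denq (w 0 l)); first by apply/prodf_neq0 => l _; rewrite denq_neq0.
exists (\row_l (numq (w 0 l) * \prod_(h | h != l) denq (w 0 h))).
apply/rowP => l; rewrite !mxE [in RHS](bigD1 l) //= !intrM numqE.
by rewrite mulrC -mulrA [RHS]mulrCA [w 0 l * _]mulrC.
Qed.

(** A linear relation between the columns of a face can be chosen integral,
and its positive and negative parts would be two optimal solutions of one
program. *)
Lemma generic_face_free c s : generic A c -> Delta A c s ->
  \rank (csub s Ar) = #|s|.
Proof.
move=> gc Ds; pose Mq : 'M[rat]_(d, #|s|) := map_mx intr (csub s A).
have -> : csub s Ar = map_mx ratr Mq.
  by apply/matrixP => i j; rewrite !mxE ratr_int.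
rewrite mxrank_map -mxrank_tr; apply/eqP; apply: contraT => nf.
have /rowV0Pn [w /sub_kermxP wM w0] : kermx Mq^T != 0 by rewrite kermx_eq0.
have [N N0 [v vE]] := rat_clear_denominators w.
pose u : 'cV[int]_n := csub s 1%:M *m v^T.
have Au : A *m u = 0.
  rewrite mulmxA -csubE; have h : map_mx (intr : int -> rat) (csub s A *m v^T) = 0.
    rewrite map_mxM -[map_mx _ (csub s A)]/Mq -map_trmx vE linearZ /= -scalemxAr.
    by rewrite -[Mq]trmxK -trmx_mul wM trmx0 scaler0.
  apply/matrixP => i j; move/matrixP/(_ i j): h; rewrite !mxE => /eqP.
  by rewrite intr_eq0 => /eqP.
pose pos (x : 'cV[int]_n) := map_mx (fun e : int => Num.max e 0) x.
have pos0 x : pos x \is a mxOver Num.nneg.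
  by apply/mxOverP => i j; rewrite mxE nnegrE le_max lexx orbT.
have us j : j \notin s -> u j 0 = 0.
  by move=> js; rewrite mxE big1 // => l _; rewrite csub1_notin ?mul0r.
have posD : pos u - pos (- u) = u.
  apply/colP => j; rewrite !mxE; move: (\sum_j _) => e.
  have [e0|/ltW e0] := leP e 0.
    by rewrite max_l ?oppr_ge0 // sub0r opprK.
  by rewrite max_r ?oppr_le0 // subr0.
have posA : A *m pos u = A *m pos (- u).
  by apply/eqP; rewrite -subr_eq0 -mulmxBr posD Au.
have [x [_ xU]] : exists! x, IP_optimal A c (A *m pos u) x.
  by apply: gc; exists (pos u).
have e1 : x = pos u.
  by apply: xU; apply: supported_optimal Ds _ _ => // j /us uj; rewrite mxE uj.
have e2 : x = pos (- u).
  apply: xU; rewrite posA; apply: supported_optimal Ds _ _ => // j /us uj.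
  by rewrite [LHS]mxE [(- u) j 0]mxE uj oppr0 maxxx.
have u0 : u = 0 by rewrite -posD -e1 -e2 subrr.
have : N%:~R *: w == 0.
  rewrite -vE; apply/eqP/rowP => k; rewrite !mxE.
  have /colP/(_ (enum_val k)) := u0; rewrite !mxE (bigD1 k) //= big1.
    by rewrite !mxE eqxx mul1r addr0 => ->.
  move=> l lk; rewrite !mxE; case: eqP => [/enum_val_inj kl|_]; rewrite ?mul0r //.
  by rewrite kl eqxx in lk.
by rewrite scaler_eq0 (negbTE w0) orbF intr_eq0 (negbTE N0).
Qed.

Context (rank_A : \rank Ar = d).

(** A functional vanishing on [A_s] is a direction in which the dual solution
of [s] can be moved, keeping [s] tight, until another column becomes tight. *)
Lemma maximal_face_full c s : maximal_face (Delta A c) s ->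
  row_free (csub s Ar).
Proof.
move=> [/face_price [y [yc ys]] smax]; apply: contraT; rewrite -kermx_eq0.
move=> /rowV0Pn [z0 /sub_kermxP z0s z00].
have z0A : z0 *m Ar != 0 by rewrite mulmx_free_eq0 // /row_free rank_A.
have [z [j zj] zs] : exists2 z : 'rV[R]_d, (exists j, 0 < (z *m Ar) 0 j) &
    z *m csub s Ar = 0.
  have /rV0Pn [j zj] := z0A; have [/ltW z0j|z0j|e] := ltgtP 0 ((z0 *m Ar) 0 j).
  - by exists z0 => //; exists j; rewrite lt_def zj.
  - exists (- z0); last by rewrite mulNmx z0s oppr0.
    by exists j; rewrite mulNmx mxE oppr_gt0.
  - by rewrite e eqxx in zj.
have zk k : k \in s -> (z *m Ar) 0 k = 0.
  move=> ks; have /rowP/(_ (enum_rank_in ks k)) := zs.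
  by rewrite csubE mulmxA -csubE !mxE enum_rankK_in.
have [k zk0|t t0 [yt [k zk0 kT]]] := ray_hit yc zj.
  rewrite lt_neqAle yc andbT; apply/negP => yk.
  have ks : k \in s by rewrite -ys inE.
  by rewrite zk ?ltxx in zk0.
have /(_ (tight_face yt)) := smax (tight A c (y + t *: z)) => e.
move: kT; rewrite e.
  by move=> ks; rewrite zk ?ltxx in zk0.
apply/fintype.subsetP => l ls; rewrite inE ray_entry.
by rewrite zk // mulr0 addr0; move: ls; rewrite -{1}ys inE.
Qed.

Lemma maximal_face_basis c s : generic A c -> maximal_face (Delta A c) s ->
  simplex_basis R A s.
Proof.
move=> gc sM; have := maximal_face_full sM; rewrite /simplex_basis => fs.
by rewrite fs andbT -(generic_face_free gc (proj1 sM)).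
Qed.

Lemma face_priceE c s : simplex_basis R A s -> Delta A c s ->
  dual_feasible A c (c *m coords R A s) /\ tight A c (c *m coords R A s) = s.
Proof.
move=> bs /face_price [y [yc ys]]; rewrite -(@price_unique _ _ _ A s c y) // => j.
by rewrite -{1}ys inE => /eqP.
Qed.

(** Subtracting a small multiple of the coordinates in [s :\: t] from the dual
solution of [s] keeps the columns of [t] tight and no others. *)
Lemma face_subset c s t : simplex_basis R A s -> Delta A c s -> t \subset s ->
  Delta A c t.
Proof.
move=> bs Ds ts; have [yc ys] := face_priceE bs Ds.
set y := c *m _ in yc ys; pose z := - \sum_(i in s :\: t) row i (coords R A s).
have zE j : j \in s -> (z *m Ar) 0 j = - (j \notin t)%:R.
  move=> js; rewrite mulNmx mulmx_suml mxE summxE; congr (- _).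
  rewrite (eq_bigr (fun i => (i == j)%:R)); last first.
    by move=> i _; rewrite -row_mul mxE coords_in.
  have [jt|jt] := boolP (j \in t).
    by rewrite big1 // => i; rewrite inE; case: eqP => // ->; rewrite jt.
  rewrite (bigD1 j) /= ?inE ?jt ?js // eqxx big1 ?addr0 // => i /andP[_ ij].
  by rewrite (negbTE ij).
have [|M M0 MP] := @large_enough R 'I_n (fun j M => 0 < M -> j \notin s ->
    (y *m Ar) 0 j + M^-1 * (z *m Ar) 0 j < c 0 j); last first.
  exists (y + M^-1 *: z); split=> j jt; rewrite ray_entry.
    have js := fintype.subsetP ts _ jt.
    by rewrite zE // jt oppr0 mulr0 addr0; move: js; rewrite -{1}ys inE => /eqP.
  have [js|js] := boolP (j \in s); last exact: MP.
  rewrite zE // jt; move: js; rewrite -{1}ys inE => /eqP ->.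
  by rewrite mulrN1 gtrDl oppr_lt0 invr_gt0.
move=> j; exists ((`|(z *m Ar) 0 j| + 1) / (c 0 j - (y *m Ar) 0 j)) => M MM M0 js.
have yj : 0 < c 0 j - (y *m Ar) 0 j.
  rewrite subr_gt0 lt_neqAle yc andbT; move: js; rewrite -{1}ys inE; exact.
rewrite -ltrBrDl mulrC ltr_pdivrMr // mulrC.
move: MM; rewrite ler_pdivrMr // => MM; apply: lt_le_trans MM.
by have := ler_norm ((z *m Ar) 0 j); lra.
Qed.

Lemma Delta_nonempty c y : (forall j, 0 < (y *m Ar) 0 j) -> exists s, Delta A c s.
Proof.
move=> y0; have [|M M0 MP] := @large_enough R 'I_n (fun j M =>
    - M * (y *m Ar) 0 j <= c 0 j); last first.
  exists (tight A c (- M *: y)); apply: tight_face => j.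
  by rewrite -scalemxAl mxE MP.
move=> j; exists (`|c 0 j| / (y *m Ar) 0 j) => M; rewrite ler_pdivrMr // => MM.
by have := ler_norm (- c 0 j); rewrite normrN; lra.
Qed.

(** Dual simplex method: take the maximal face whose dual solution has the
largest value at [v]. If a coordinate [i] of [v] were negative, moving along the
opposite of that coordinate would raise the value until a column [k] becomes
tight, and replacing [i] by [k] would give a better maximal face. *)
Lemma maximal_faces_cover c (v : 'cV[R]_d) : generic A c ->
  (exists s, Delta A c s) -> cone Ar v ->
  exists2 s, maximal_face (Delta A c) s & forall i, 0 <= (coords R A s *m v) i 0.
Proof.
move=> gc [s0 /face_sub_maximal [s1 s1M _]] [u u0 vE].
have /(arg_maxP (fun s => (c *m (coords R A s *m v)) 0 0)) :
  [pred s | `[< maximal_face (Delta A c) s >]] s1 by apply/asboolP.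
case=> s /asboolP sM smax; exists s => // i; rewrite leNgt; apply/negP => vi.
have bs := maximal_face_basis gc sM; have [yc ys] := face_priceE bs (proj1 sM).
set y := c *m _ in yc ys.
have is_ : i \in s by apply: contraTT vi => is_; rewrite coords_notin ?ltxx.
pose z := - row i (coords R A s).
have zE k : k \in s -> (z *m Ar) 0 k = - (i == k)%:R.
  by move=> ks; rewrite mulNmx -row_mul !mxE -(coords_in i bs ks) mxE.
have zv : 0 < (z *m v) 0 0.
  by rewrite mulNmx -row_mul mxE [X in - X]mxE oppr_gt0.
have [j zj] : exists j, 0 < (z *m Ar) 0 j.
  apply: contrapT => nex; move: zv; rewrite vE mulmxA mxE ltNge => /negP; apply.
  apply: sumr_le0 => j _; apply: mulr_le0_ge0; last exact: (mxOverP u0).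
  by rewrite leNgt; apply/negP => zj; apply: nex; exists j.
have zs k : 0 < (z *m Ar) 0 k -> k \notin s.
  by move=> zk; apply/negP => /zE e; move: zk; rewrite e oppr_gt0 ltrn0.
have [k zk|t t0 [yt [k zk kT]]] := ray_hit yc zj.
  rewrite lt_neqAle yc andbT; have := zs _ zk; by rewrite -{1}ys inE.
have [s' s'M Ts'] := face_sub_maximal (tight_face yt).
have bs' := maximal_face_basis gc s'M.
have sT : k |: (s :\ i) \subset tight A c (y + t *: z).
  apply/fintype.subsetP => l; rewrite in_setU1 => /predU1P[->//|].
  rewrite in_setD1 => /andP[li ls]; rewrite inE ray_entry.
  rewrite zE // [i == l]eq_sym (negbTE li) oppr0 mulr0 addr0.
  by move: ls; rewrite -{1}ys inE.
(* Both sides have [d] elements, so the new face is determined by the exchange. *)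
have s'E : k |: (s :\ i) = s'.
  apply/eqP; rewrite eqEcard (fintype.subset_trans sT Ts') /=.
  rewrite cardsU1 in_setD1 (negbTE (zs _ zk)) andbF /= add1n.
  case/andP: bs => /eqP sd _; case/andP: bs' => /eqP s'd _; rewrite s'd.
  by rewrite -sd (cardsD1 i s) is_.
have y'E : y + t *: z = c *m coords R A s'.
  apply: price_unique bs' _ => l; rewrite -s'E => /(fintype.subsetP sT).
  by rewrite inE => /eqP.
have := smax s' (asboolT s'M).
rewrite /= (mulmxA c (coords R A s')) (mulmxA c (coords R A s)) -y'E ray_entry.
by rewrite gerDl leNgt mulr_gt0.
Qed.

End Triangulation.

(** * The convex piecewise linear function of a triangulation *)

Section Interpolation.
Context (R : realType) (d n : nat) (A : 'M[int]_(d, n)).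
Notation Ar := (toR R A).
Implicit Types (s t : {set 'I_n}) (c : 'rV[R]_n) (v : 'cV[R]_d).

(** For a maximal face [s] this is membership in [cone (csub s Ar)], by
[cone_coords]. *)
Definition in_simplex s v := forall i, 0 <= (coords R A s *m v) i 0.

(** The reduced cost for [s], extended by zeros to all indices. *)
Definition slack c s : 'rV[R]_n := c - c *m coords R A s *m Ar.

Lemma slackE c s j : slack c s 0 j = c 0 j - (c *m coords R A s *m Ar) 0 j.
Proof. by rewrite mxE [X in _ + X]mxE. Qed.

Lemma slack_in c s j : simplex_basis R A s -> j \in s -> slack c s 0 j = 0.
Proof. by move=> bs js; rewrite slackE price_in // subrr. Qed.

Lemma coords_price c s v :
  (c *m coords R A s *m v) 0 0 = \sum_i c 0 i * (coords R A s *m v) i 0.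
Proof. by rewrite -mulmxA mxE. Qed.

Lemma price_sum (y : 'rV[R]_d) v s : simplex_basis R A s ->
  (y *m v) 0 0 = \sum_i (y *m Ar) 0 i * (coords R A s *m v) i 0.
Proof.
move=> bs; have vE : v = Ar *m (coords R A s *m v).
  by rewrite mulmxA coordsK // mul1mx.
by rewrite [in LHS]vE mulmxA mxE.
Qed.

Lemma col_price (y : 'rV[R]_d) j : (y *m col j Ar) 0 0 = (y *m Ar) 0 j.
Proof. by rewrite colE mulmxA -colE mxE. Qed.

Lemma cone_col j : cone Ar (col j Ar).
Proof.
exists (delta_mx j 0); last by rewrite colE.
by apply/mxOverP => i k; rewrite mxE nnegrE ler0n.
Qed.

Context (D : set {set 'I_n}).
Context (D_basis : forall s, maximal_face D s -> simplex_basis R A s).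
Context (D_cover : forall v, cone Ar v ->
  exists2 s, maximal_face D s & in_simplex s v).

(** A cost vector with positive reduced costs off the maximal faces of [D]
has no other faces: if [t] is a face, compare at the sum of its columns, which
lies in the cone of some maximal face [s]; the dual solution of [t] is optimal
there, so complementary slackness forces [t \subset s]. *)
Lemma Delta_of_slack c :
  (forall s t, maximal_face D s -> t \subset s -> D t) ->
  (forall s, maximal_face D s -> forall j, j \notin s -> 0 < slack c s 0 j) ->
  D = Delta A c.
Proof.
move=> D_sub cD; apply/seteqP; split=> t.
  move=> /face_sub_maximal [s sM ts]; have bs := D_basis sM.
  apply: (face_subset bs) ts; exists (c *m coords R A s); split=> j js.
    exact: price_in.
  by rewrite -subr_gt0 -slackE cD.
move=> [y [yt ynt]].
pose e : 'cV[R]_n := \col_j (j \in t)%:R.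
have e0 j : 0 <= e j 0 by rewrite mxE ler0n.
have [|s sM sv] := D_cover (v := Ar *m e).
  by exists e => //; apply/mxOverP => i j; rewrite ord1 nnegrE.
have bs := D_basis sM; apply: (D_sub _ _ sM).
apply/fintype.subsetP => k kt; apply: contraT => ks.
have h1 : (c *m coords R A s *m (Ar *m e)) 0 0 < \sum_j c 0 j * e j 0.
  rewrite mulmxA mxE (bigD1 k) //= [ltRHS](bigD1 k) //=; apply: ltr_leD.
    have -> : e k 0 = 1 by rewrite mxE kt.
    by rewrite !mulr1 -subr_gt0 -slackE cD.
  apply: ler_sum => j _; apply: ler_wpM2r => //.
  rewrite -subr_ge0 -slackE; have [js|js] := boolP (j \in s).
    by rewrite slack_in.
  by rewrite ltW // cD.
have h2 : (y *m (Ar *m e)) 0 0 = \sum_j c 0 j * e j 0.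
  rewrite mulmxA mxE; apply: eq_bigr => j _; have [jt|jt] := boolP (j \in t).
    by rewrite yt.
  have -> : e j 0 = 0 by rewrite mxE (negbTE jt).
  by rewrite !mulr0.
have h3 : (y *m (Ar *m e)) 0 0 <= (c *m coords R A s *m (Ar *m e)) 0 0.
  rewrite (price_sum _ _ bs) coords_price; apply: ler_sum => j _.
  apply: ler_wpM2r; first exact: sv.
  by have [jt|jt] := boolP (j \in t); [rewrite yt|rewrite ltW // ynt].
by move: h1; rewrite -h2 ltNge h3.
Qed.

Context (w : 'rV[R]_n) (w_pos : forall j, 0 < w 0 j).
Context (w_slack : forall s, maximal_face D s ->
  forall j, j \notin s -> 0 < slack w s 0 j).
Context (ker_A : [set u : 'cV[R]_n | Ar *m u = 0 /\ u \is a mxOver Num.nneg]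
             = [set 0]).

(** The linear function that interpolates the heights [w] on [s]. *)
Definition value s v := (w *m coords R A s *m v) 0 0.

Lemma value_sum s t v : maximal_face D t ->
  value s v = \sum_i (w 0 i - slack w s 0 i) * (coords R A t *m v) i 0.
Proof.
move=> tM; rewrite /value (price_sum _ _ (D_basis tM)); apply: eq_bigr => i _.
by rewrite slackE subKr.
Qed.

Lemma slack_ge0 s j : maximal_face D s -> 0 <= slack w s 0 j.
Proof.
move=> sM; have [js|js] := boolP (j \in s); last by rewrite ltW // w_slack.
by rewrite slack_in // D_basis.
Qed.

Lemma value_le s t v : maximal_face D s -> maximal_face D t -> in_simplex t v ->
  value s v <= value t v.
Proof.
move=> sM tM vt; rewrite (value_sum s v tM) /value coords_price.
apply: ler_sum => i _; apply: ler_wpM2r => //.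
by rewrite gerBl slack_ge0.
Qed.

(** Strict convexity: off the cone of [s], some coordinate of [v] outside [s]
is positive, and there [w] lies strictly above the linear function of [s]. *)
Lemma value_lt s t v : maximal_face D s -> maximal_face D t -> in_simplex t v ->
  ~ in_simplex s v -> value s v < value t v.
Proof.
move=> sM tM vt vs; rewrite lt_neqAle value_le // andbT; apply/eqP => e; apply: vs.
have [bs bt] := (D_basis sM, D_basis tM).
have vE : v = Ar *m (coords R A t *m v) by rewrite mulmxA coordsK // mul1mx.
suff st : coords R A s *m v = coords R A t *m v by move=> i; rewrite st.
rewrite [in LHS]vE coords_mul // => i is_.
apply/eqP; apply: contraT => i0.
have : 0 < \sum_i slack w s 0 i * (coords R A t *m v) i 0.
  rewrite (bigD1 i) //= ltr_wpDr //.
    by apply: sumr_ge0 => k _; rewrite mulr_ge0 // slack_ge0.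
  by rewrite mulr_gt0 ?w_slack // lt_neqAle eq_sym i0 vt.
suff -> : \sum_i slack w s 0 i * (coords R A t *m v) i 0 = value t v - value s v.
  by rewrite e subrr ltxx.
rewrite (value_sum s v tM) /value coords_price -sumrB; apply: eq_bigr => k _.
by rewrite mulrBl subKr.
Qed.

Lemma value_col_gt0 s j : maximal_face D s -> in_simplex s (col j Ar) ->
  0 < value s (col j Ar).
Proof.
move=> sM js; rewrite /value coords_price.
have [i i0] : exists i, (coords R A s *m col j Ar) i 0 != 0.
  apply/cV0Pn; apply/eqP => e0.
  have aj : col j Ar = 0.
    by rewrite -[LHS]mul1mx -(coordsK (D_basis sM)) -mulmxA e0 mulmx0.
  have : [set u : 'cV[R]_n | Ar *m u = 0 /\ u \is a mxOver Num.nneg] (delta_mx j 0).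
    split; first by rewrite -colE.
    by apply/mxOverP => i k; rewrite mxE nnegrE ler0n.
  rewrite ker_A => /colP /(_ j); rewrite !mxE !eqxx /= => /eqP.
  by rewrite oner_eq0.
rewrite (bigD1 i) //= ltr_wpDr //.
  by apply: sumr_ge0 => k _; rewrite mulr_ge0 // ltW.
by rewrite mulr_gt0 // lt_neqAle eq_sym i0 js.
Qed.

(** [g] lists the values at the columns of the maximum of the linear functions
[value s]. *)
Lemma interpolation : exists g : 'rV[R]_n,
  [/\ forall j, 0 < g 0 j,
      forall s j, maximal_face D s -> j \in s -> g 0 j = w 0 j,
      forall s j, maximal_face D s -> in_simplex s (col j Ar) ->
        g 0 j = value s (col j Ar) &
      forall s j, maximal_face D s -> ~ in_simplex s (col j Ar) ->
        value s (col j Ar) < g 0 j].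
Proof.
have /choice [f fP] : forall j, exists s,
    maximal_face D s /\ in_simplex s (col j Ar).
  by move=> j; have [s] := D_cover (cone_col j); exists s.
have gE s j : maximal_face D s -> in_simplex s (col j Ar) ->
    value (f j) (col j Ar) = value s (col j Ar).
  by move=> sM js; case: (fP j) => fM fj; apply/eqP; rewrite eq_le !value_le.
exists (\row_j value (f j) (col j Ar)); split=> [j|s j sM js|s j sM js|s j sM js].
- by rewrite mxE; case: (fP j); apply: value_col_gt0.
- have bs := D_basis sM; rewrite mxE (gE s) // => [|i].
    by rewrite /value col_price price_in.
  by rewrite colE mulmxA -colE mxE coords_in // ler0n.
- by rewrite mxE; apply: gE.
- by rewrite mxE; case: (fP j) => fM fj; apply: value_lt.
Qed.

End Interpolation.

(** * Integral cost vectors near a piecewise linear function *)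

(** The lowest nonzero digit would be divisible by [W]. *)
Lemma small_digits_eq0 (n W : nat) (v : 'I_n -> int) :
  (forall j, `|v j| < W%:Z) -> (W%:Z ^+ n %| \sum_j v j * W%:Z ^+ j)%Z ->
  forall j, v j = 0.
Proof.
move=> vW dv; suff h k : forall j : 'I_n, (j < k)%N -> v j = 0.
  by move=> j; apply: (h n).
elim: k => // k IHk j; rewrite ltnS leq_eqVlt => /predU1P[jk|]; last exact: IHk.
have W0 : 0 < W%:Z by apply: le_lt_trans (vW j).
have : (W%:Z ^+ k.+1 %| v j * W%:Z ^+ k)%Z.
  have : (W%:Z ^+ k.+1 %| \sum_i v i * W%:Z ^+ i)%Z.
    by apply: dvdz_trans _ dv; rewrite dvdz_exp2l // -jk.
  rewrite (bigD1 j) //= [in X in X + _]jk rpredDr //.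
  apply: rpred_sum => i ij; have [ik|ik|ik] := ltngtP i k.
  - by rewrite IHk // mul0r rpred0.
  - by rewrite dvdz_mull // dvdz_exp2l.
  - by move: ij; rewrite -val_eqE /= ik jk eqxx.
rewrite exprS dvdz_mul2r ?expf_neq0 ?gt_eqF // => Wv.
apply/eqP; rewrite -absz_eq0; apply: contraT; rewrite -lt0n => v0.
move: Wv; rewrite dvdzE => /(dvdn_leq v0); rewrite absz_nat leqNgt.
by have := vW j; rewrite -abszE ltz_nat => ->.
Qed.

(** The witness is [c_j = W^n floor(N q_j) + W^j]: the first summand carries the
approximation, the second one is all that is left of a cost modulo [W^n]. *)
Lemma integral_approximation (R : realType) (n : nat) (q : 'rV[R]_n) (W N : nat) :
  (0 < W)%N -> exists c : 'rV[int]_n,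
    (forall j, `|(c 0 j)%:~R - N%:R * W%:R ^+ n * q 0 j| <= 2 * W%:R ^+ n) /\
    (forall v : 'cV[int]_n, (forall j, `|v j 0| < W%:Z) ->
       (c *m v) 0 0 = 0 -> v = 0).
Proof.
move=> W0; pose k j := Num.floor (N%:R * q 0 j).
exists (\row_j (W%:Z ^+ n * k j + W%:Z ^+ j)); split=> [j|v vW].
  rewrite mxE rmorphD rmorphM !rmorphXn /= -[W%:~R]/(W%:R : R).
  set Wn := W%:R ^+ n.
  have Wn0 : 0 <= Wn by rewrite exprn_ge0.
  have Wj : (W%:R : R) ^+ j <= Wn by rewrite ler_weXn2l ?ler1n // ltnW.
  have Wj0 : 0 <= (W%:R : R) ^+ j by rewrite exprn_ge0.
  have /andP[k1] := floor_itv (N%:R * q 0 j); rewrite -/(k j) intrD => k2.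
  have -> : Wn * (k j)%:~R + W%:R ^+ j - N%:R * Wn * q 0 j
      = W%:R ^+ j - Wn * (N%:R * q 0 j - (k j)%:~R).
    by rewrite mulrBr; lra.
  have : Wn * (N%:R * q 0 j - (k j)%:~R) <= Wn * 1.
    by apply: ler_wpM2l => //; lra.
  have : 0 <= Wn * (N%:R * q 0 j - (k j)%:~R) by rewrite mulr_ge0 // subr_ge0.
  by rewrite ler_norml; lra.
move=> cv; apply/colP => j; rewrite [RHS]mxE.
apply: (small_digits_eq0 (v := fun i => v i 0)) => //.
apply/dvdzP; exists (- \sum_i k i * v i 0).
rewrite mulNr; apply/eqP; rewrite -addr_eq0 -[X in _ == X]cv mxE mulr_suml.
rewrite -big_split; apply/eqP; apply: eq_bigr => i _; rewrite mxE /= mulrDl addrC.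
by congr (_ + _); rewrite mulrC // mulrA.
Qed.

Section Cost.
Context (R : realType) (d n : nat) (A : 'M[int]_(d, n)).
Notation Ar := (toR R A).
Implicit Types (s : {set 'I_n}) (c : 'rV[R]_n).

Lemma slack_linear s (P : R) c c' j :
  slack A (c - P *: c') s 0 j = slack A c s 0 j - P * slack A c' s 0 j.
Proof.
have e (x : 'rV[R]_n) : slack A x s = x *m (1%:M - coords R A s *m Ar).
  by rewrite mulmxBr mulmx1 mulmxA.
rewrite !e mulmxBl -scalemxAl; move: (c *m _) (c' *m _) => u v.
by rewrite !mxE.
Qed.

(** A bound for the norm of the linear form [slack _ s 0 j] with respect to the
maximum norm. *)
Definition slack_norm s j : R := 1 + \sum_i `|(coords R A s *m Ar) i j|.

Lemma slack_bound s c (e : R) j : (forall i, `|c 0 i| <= e) ->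
  `|slack A c s 0 j| <= e * slack_norm s j.
Proof.
move=> ce; rewrite slackE mulrDr mulr1 (le_trans (ler_normB _ _)) //.
apply: lerD => //; rewrite -mulmxA mxE mulr_sumr.
apply: le_trans (ler_norm_sum _ _ _) _; apply: ler_sum => i _.
by rewrite normrM ler_wpM2r.
Qed.

Context (D : set {set 'I_n}).
Context (D_basis : forall s, maximal_face D s -> simplex_basis R A s).
Context (D_cover : forall v, cone Ar v ->
  exists2 s, maximal_face D s & in_simplex A s v).
Context (w : 'rV[R]_n) (w_pos : forall j, 0 < w 0 j).
Context (w_slack : forall s, maximal_face D s ->
  forall j, j \notin s -> 0 < slack A w s 0 j).
Context (ker_A : [set u : 'cV[R]_n | Ar *m u = 0 /\ u \is a mxOver Num.nneg]
             = [set 0]).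

(** Up to the scale [P], the reduced costs for [s] agree with the linear
function [value s] with relative error [th] on the columns in the cone of [s],
and exceed the constant [C] on the others. *)
Definition adapted (th C P : R) c := forall s, maximal_face D s ->
  forall j, j \notin s ->
    (in_simplex A s (col j Ar) ->
       (1 - th) * P * value A w s (col j Ar) <= slack A c s 0 j /\
       slack A c s 0 j <= (1 + th) * P * value A w s (col j Ar)) /\
    (~ in_simplex A s (col j Ar) -> (C + 1) * P <= slack A c s 0 j).

(** The vector to approximate is [q_j = M g_j] at the columns of the faces and
[q_j = (M + 1) g_j] at the others: its reduced costs are the differences
[M (g_j - value s a_j)], zero in the cone of [s] and large outside, plus [g_j] at
the columns that are on no face. *)
Lemma adapted_cost_exists (th C : R) (W : nat) : 0 < th -> (0 < W)%N ->
  exists2 P : R, 0 < P & exists2 c : 'rV[int]_n, adapted th C P (toR R c) &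
    forall v : 'cV[int]_n, (forall j, `|v j 0| < W%:Z) ->
      (c *m v) 0 0 = 0 -> v = 0.
Proof.
move=> th0 W0.
have [g [g0 gw gin gout]] := interpolation D_basis D_cover w_pos w_slack ker_A.
pose val s j := value A w s (col j Ar).
have [|M M0 MP] := @large_enough R ({set 'I_n} * 'I_n)%type (fun p M =>
    maximal_face D p.1 -> ~ in_simplex A p.1 (col p.2 Ar) ->
    C + 2 <= M * (g 0 p.2 - val p.1 p.2)).
  move=> [s j] /=; have [sM|] := pselect (maximal_face D s); last by exists 0.
  have [sj|sj] := pselect (in_simplex A s (col j Ar)); first by exists 0.
  exists ((C + 2) / (g 0 j - val s j)) => M MM _ _.
  by rewrite -ler_pdivrMr // subr_gt0; apply: gout.
pose ray j := `[< exists2 s, maximal_face D s & j \in s >].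
pose q : 'rV[R]_n := \row_j ((M + (~~ ray j)%:R) * g 0 j).
have q_slack s j : maximal_face D s ->
    slack A q s 0 j = M * (g 0 j - val s j) + (~~ ray j)%:R * g 0 j.
  move=> sM; rewrite slackE -mulmxA mul_coords.
  rewrite (eq_bigr (fun i => M * (w 0 i * (coords R A s *m Ar) i j))).
    rewrite -mulr_sumr -mul_coords mulmxA /val /value col_price mxE.
    by rewrite mulrDl mulrBr addrAC.
  move=> i is_; rewrite mxE (gw s) // (_ : ray i) ?addr0 ?mulrA //.
  by apply/asboolP; exists s.
have [|N0 N00 NP] := @large_enough R ({set 'I_n} * 'I_n)%type (fun p N =>
    (maximal_face D p.1 -> in_simplex A p.1 (col p.2 Ar) ->
      2 * slack_norm p.1 p.2 <= th * N * val p.1 p.2) /\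
    2 * slack_norm p.1 p.2 <= N).
  move=> [s j] /=; have [sM|sM] := pselect (maximal_face D s); last first.
    by exists (2 * slack_norm s j) => N NN; split.
  have [sj|sj] := pselect (in_simplex A s (col j Ar)); last first.
    by exists (2 * slack_norm s j) => N NN; split.
  have val0 : 0 < val s j := value_col_gt0 D_basis w_pos ker_A sM sj.
  exists (Num.max (2 * slack_norm s j) (2 * slack_norm s j / (th * val s j))) => N.
  rewrite ge_max => /andP[N1]; rewrite ler_pdivrMr ?mulr_gt0 // => N2.
  by split=> // _ _; move: N2; rewrite mulrA [N * _]mulrC.
pose N := Num.Def.archi_bound N0.
have N0N : N0 <= N%:R by rewrite ltW // archi_boundP // ltW.
have [c [cq cv]] := integral_approximation q N W0.
have Wn0 : 0 < (W%:R : R) ^+ n by rewrite exprn_gt0 // ltr0n.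
have N1 : 0 < N%:R :> R := lt_le_trans N00 N0N.
pose P : R := N%:R * W%:R ^+ n; have P0 : 0 < P by exact: mulr_gt0.
exists P => //; exists c => // s sM j js.
have sl : `|slack A (toR R c) s 0 j - P * slack A q s 0 j|
    <= 2 * W%:R ^+ n * slack_norm s j.
  rewrite -slack_linear; apply: slack_bound => i.
  by rewrite !mxE; have := cq i; rewrite !mxE.
move: sl; rewrite q_slack // ler_norml => /andP[sl1 sl2].
have [NPin NPout] := NP _ (s, j) N0N; split=> sj.
  have gE : g 0 j = val s j by apply: gin.
  (* By strict convexity a column of some face lies in the cone of a maximal face only
     if it belongs to it. *)
  have jr : ~~ ray j.
    apply/asboolP => -[t tM jt]; have := w_slack sM js.
    by rewrite slackE -(gw t) // gE -col_price subrr ltxx.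
  have := NPin sM sj; rewrite /= => NPv.
  have : W%:R ^+ n * (2 * slack_norm s j) <= W%:R ^+ n * (th * N%:R * val s j).
    by apply: ler_wpM2l => //; exact: ltW.
  move: sl1 sl2; rewrite jr gE subrr mulr0 add0r mul1r -/(val s j) => sl1 sl2 NPv'.
  have e1 : W%:R ^+ n * (th * N%:R * val s j) = th * (P * val s j).
    by rewrite /P; lra.
  by split; lra.
have h1 : W%:R ^+ n * (2 * slack_norm s j) <= P.
  by rewrite /P mulrC; apply: ler_wpM2r => //; exact: ltW.
have h2 : P * (C + 2) <= P * (M * (g 0 j - val s j)).
  by apply: ler_wpM2l; [exact: ltW|exact: (MP _ (s, j))].
have h3 : 0 <= P * ((~~ ray j)%:R * g 0 j).
  by rewrite !mulr_ge0 // ltW.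
by move: sl1 sl2 h1 h2 h3; lra.
Qed.

End Cost.

(** * Group relaxations whose reduced costs are nearly linear *)

Lemma int_set_min (S : int -> Prop) (l : int) :
  (exists z, S z) -> (forall z, S z -> l <= z) ->
  exists2 z, S z & forall z', S z' -> z <= z'.
Proof.
move=> [z0 Sz0] Sl; pose p k := `[< S (l + Posz k) >].
have pE z : S z -> p `|z - l|%N.
  by move=> Sz; apply/asboolP; rewrite gez0_abs ?subr_ge0 ?Sl // addrCA subrr addr0.
case: (ex_minnP (ex_intro (fun k => is_true (p k)) _ (pE _ Sz0))) => k /asboolP Sk kmin.
exists (l + Posz k) => // z Sz; rewrite -lerBrDl -[leRHS]gez0_abs ?subr_ge0 ?Sl //.
by rewrite lez_nat; apply: kmin; apply: pE.
Qed.

Section Relaxation.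
Context (R : realType) (d n : nat) (A : 'M[int]_(d, n)).
Notation Ar := (toR R A).
Implicit Types (s : {set 'I_n}) (b : 'cV[int]_d) (x : 'cV[int]_n).

Definition group_feasible s b x := A *m x = b /\ forall j, j \notin s -> 0 <= x j 0.

Lemma G_feasibleE s b x : G_feasible A s b x <-> group_feasible s b x.
Proof.
rewrite /G_feasible /group_feasible /= csub_rsub_sum; split=> -[Ax x0]; split=> //.
  move=> j js; have js' : j \in ~: s by rewrite inE.
  have := mxOverP x0 (enum_rank_in js' j) 0; rewrite mxE enum_rankK_in //.
apply/mxOverP => k l; rewrite ord1 mxE nnegrE; apply: x0.
by have := enum_valP k; rewrite inE.
Qed.

Lemma G_optimalE (c : 'rV[R]_n) s b x : simplex_basis R A s ->
  G_optimal A c s b x <-> group_feasible s b x /\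
    forall x', group_feasible s b x' -> cost c x <= cost c x'.
Proof.
move=> bs; split=> -[/G_feasibleE fx xmin]; split=> // x' /G_feasibleE fx'.
  have := xmin _ fx'; rewrite !cost_reduced //.
  by move/G_feasibleE: fx' => [-> _]; move: fx => [-> _]; rewrite lerD2r.
have := xmin _ fx'; rewrite !cost_reduced //.
by move: fx' => [-> _]; move/G_feasibleE: fx => [-> _]; rewrite lerD2r.
Qed.

Lemma cost_slack (c : 'rV[R]_n) s x : cost c x =
  (c *m coords R A s *m toR R (A *m x)) 0 0 + \sum_j slack A c s 0 j * (x j 0)%:~R.
Proof.
rewrite price_mulE costE -big_split; apply: eq_bigr => j _ /=.
by rewrite -mulrDl slackE addrC subrK.
Qed.

Context (D : set {set 'I_n}).
Context (D_basis : forall s, maximal_face D s -> simplex_basis R A s).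
Context (w : 'rV[R]_n) (w_pos : forall j, 0 < w 0 j).
Context (normal_D : Delta_normal R A D).
Context (th P : R) (th0 : 0 < th) (th1 : th < 1) (P0 : 0 < P).
Let C : R := \sum_j w 0 j.
Context (th_small : forall k (F : R), 0 <= F -> F <= C ->
  (1 + th) * F < (1 - th) * (F + w 0 k)).
Context (c : 'rV[int]_n) (c_adapted : adapted A D w th (2 * C) P (toR R c)).

Let cr := toR R c.
Let beta s b := coords R A s *m toR R b.
Let flo s b : 'cV[int]_n := \col_i Num.floor (beta s b i 0).
Let frac_value s b := \sum_i w 0 i * (beta s b i 0 - (flo s b i 0)%:~R).

Lemma frac_value_bounds s b : 0 <= frac_value s b <= C.
Proof.
have h i : 0 <= beta s b i 0 - (flo s b i 0)%:~R <= 1.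
  rewrite [flo _ _ _ _]mxE; have /andP[h1] := floor_itv (beta s b i 0).
  by rewrite intrD => h2; apply/andP; split; lra.
apply/andP; split; first apply: sumr_ge0 => i _; last apply: ler_sum => i _.
  by rewrite mulr_ge0 ?(ltW (w_pos i)) //; case/andP: (h i).
by rewrite ler_piMr ?(ltW (w_pos i)) //; case/andP: (h i).
Qed.


Lemma C_ge0 : 0 <= C.
Proof. by apply: sumr_ge0 => j _; rewrite ltW. Qed.

Lemma col_sum_price (y : 'rV[R]_d) x :
  (y *m toR R (A *m x)) 0 0 = \sum_j (y *m col j Ar) 0 0 * (x j 0)%:~R.
Proof. by rewrite price_mulE; apply: eq_bigr => j _; rewrite col_price. Qed.

(** Normality applies to the point whose coordinates are the fractional parts
of those of [b]. *)
Lemma rounded_solution s b : maximal_face D s -> in_simplex A s (toR R b) ->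
  exists x, [/\ A *m x = b, x \is a mxOver Num.nneg &
    \sum_j slack A cr s 0 j * (x j 0)%:~R <= (1 + th) * P * frac_value s b].
Proof.
move=> sM sb; have bs := D_basis sM.
have flo_out j : j \notin s -> flo s b j 0 = 0.
  by move=> js; rewrite mxE /beta coords_notin // floor0.
have fracE : coords R A s *m toR R (b - A *m flo s b)
    = beta s b - toR R (flo s b).
  have -> : toR R (b - A *m flo s b) = toR R b - Ar *m toR R (flo s b).
    by rewrite -toR_mul; apply/matrixP => i j; rewrite !mxE rmorphB.
  rewrite mulmxBr coords_mul // => i is_.
  by rewrite mxE flo_out.
have [|u [u0 uK uE]] := normal_D sM (z := b - A *m flo s b).
  apply/(cone_coords _ bs) => i; rewrite fracE subrmxE subr_ge0.
  by rewrite toRE [flo _ _ _ _]mxE floor_le.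
exists (u + flo s b); split.
- by rewrite mulmxDr -uE subrK.
- apply/mxOverP => i j; rewrite ord1 mxE nnegrE addr_ge0 //; first exact: (mxOverP u0).
  by rewrite mxE floor_ge_int; exact: sb.
have -> : frac_value s b = \sum_j value A w s (col j Ar) * (u j 0)%:~R.
  rewrite -col_sum_price -uE coords_price fracE; apply: eq_bigr => i _.
  by congr (_ * _); rewrite subrmxE toRE.
rewrite mulr_sumr; apply: ler_sum => j _; rewrite mulrA.
have [js|js] := boolP (j \in s).
  rewrite slack_in // mul0r; apply: mulr_ge0; last exact: nneg_entry.
  apply: mulr_ge0; first by apply: mulr_ge0; [rewrite addr_ge0 ?(ltW th0)|exact: ltW].
  by rewrite /value col_price price_in // ltW.
rewrite [(u + _) j 0]mxE flo_out // addr0.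
have [->|uj] := eqVneq (u j 0) 0; first by rewrite !mulr0.
apply: ler_wpM2r; first exact: nneg_entry.
have [Kin _] := c_adapted sM js.
have aE : toR R (col j A) = col j Ar by apply/colP => i; rewrite !mxE.
by move/(cone_coords _ bs): (uK _ uj); rewrite aE => /Kin [].
Qed.

(** Turns a bound on the reduced cost of a feasible point into a bound on its
entries off [s]. *)
Lemma slack_adapted_gt s j (e : R) : maximal_face D s -> j \notin s ->
  1 <= e -> (in_simplex A s (col j Ar) ->
    1 <= e * ((1 - th) * value A w s (col j Ar))) ->
  P <= e * slack A cr s 0 j.
Proof.
move=> sM js e1 eK; have [Kin Kout] := c_adapted sM js.
have C0 := C_ge0.
have [sj|sj] := pselect (in_simplex A s (col j Ar)).
  have [h _] := Kin sj; have := eK sj => h'.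
  apply: (@le_trans _ _ (e * ((1 - th) * P * value A w s (col j Ar)))); last first.
    by apply: ler_wpM2l => //; move: e1; lra.
  have -> : e * ((1 - th) * P * value A w s (col j Ar)) =
    P * (e * ((1 - th) * value A w s (col j Ar))) by lra.
  by rewrite ler_peMr // ltW.
have h := Kout sj; have h2 : P <= slack A cr s 0 j.
  apply: le_trans h; rewrite ler_peMl ?(ltW P0) //; lra.
have h3 : 0 <= slack A cr s 0 j := le_trans (ltW P0) h2.
by rewrite (le_trans h2) // ler_peMl.
Qed.

Lemma slack_adapted_ge0 s j : maximal_face D s -> 0 <= slack A cr s 0 j.
Proof.
move=> sM; have [js|js] := boolP (j \in s).
  by rewrite slack_in // D_basis.
have [Kin Kout] := c_adapted sM js; have C0 := C_ge0.
have [sj|sj] := pselect (in_simplex A s (col j Ar)); last first.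
  by apply: le_trans (Kout sj); apply: mulr_ge0; [lra|exact: ltW].
apply: le_trans (proj1 (Kin sj)); apply: mulr_ge0.
  by apply: mulr_ge0; [rewrite subr_ge0 ltW|exact: ltW].
rewrite /value coords_price; apply: sumr_ge0 => i _.
by rewrite mulr_ge0 // ltW.
Qed.

Lemma slack_term s b x j : maximal_face D s -> group_feasible s b x ->
  0 <= slack A cr s 0 j * (x j 0)%:~R.
Proof.
move=> sM [_ x0]; have [js|js] := boolP (j \in s).
  by rewrite slack_in ?mul0r // D_basis.
by rewrite mulr_ge0 ?slack_adapted_ge0 // ler0z x0.
Qed.

(** Feasible points no dearer than the rounded solution have bounded terms:
the integrality of [x] then excludes columns outside the cone of [s]. *)
Lemma cheap_entry s b x j : maximal_face D s -> group_feasible s b x ->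
  \sum_j slack A cr s 0 j * (x j 0)%:~R <= (1 + th) * P * frac_value s b ->
  slack A cr s 0 j * (x j 0)%:~R <= 2 * C * P.
Proof.
move=> sM fx xc; apply: (@le_trans _ _ ((1 + th) * P * frac_value s b)).
  apply: le_trans xc; rewrite (bigD1 j) //= lerDl.
  by apply: sumr_ge0 => i _; exact: slack_term fx.
have /andP[F0 FC] := frac_value_bounds s b.
have -> : 2 * C * P = 2 * P * C by lra.
apply: ler_pM => //; first by apply: mulr_ge0; [move: th0; lra|exact: ltW].
by rewrite ler_wpM2r ?(ltW P0) //; move: th1; lra.
Qed.

(** The entries [x_i], [i] in [s], are the differences between the coordinates
[beta] of [b] and the coordinates [dl] of the contribution of the columns off
[s]. Since [dl] is nonnegative and congruent to [beta], it is at least the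
fractional part of [beta], and a negative [x_k] adds 1 to coordinate [k], more
than the cost of a rounded solution allows. *)
Lemma cheap_nonneg s b x : maximal_face D s -> in_simplex A s (toR R b) ->
  group_feasible s b x ->
  \sum_j slack A cr s 0 j * (x j 0)%:~R <= (1 + th) * P * frac_value s b ->
  x \is a mxOver Num.nneg.
Proof.
move=> sM sb fx xc; have bs := D_basis sM; have [Ax x0] := fx; have C0 := C_ge0.
have xK j : j \notin s -> x j 0 != 0 -> in_simplex A s (col j Ar).
  move=> js xj; apply: contrapT => /(proj2 (c_adapted sM js)) out.
  have xj1 : 1 <= (x j 0)%:~R :> R by rewrite ler1z; by rewrite -gtz0_ge1 lt_def xj x0.
  have := cheap_entry j sM fx xc.
  have : (2 * C + 1) * P <= slack A cr s 0 j * (x j 0)%:~R.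
    apply: le_trans out _; rewrite ler_peMr // slack_adapted_ge0 //.
  by move: P0; lra.
apply/mxOverP => k l; rewrite ord1 nnegrE leNgt; apply/negP => xk.
have ks : k \in s by apply: contraTT xk => /x0; rewrite -leNgt.
pose xs : 'cV[int]_n := \col_j (if j \in s then x j 0 else 0).
pose xo : 'cV[int]_n := \col_j (if j \in s then 0 else x j 0).
have xE : x = xo + xs.
  by apply/colP => j; rewrite !mxE; case: ifP; rewrite ?add0r ?addr0.
pose dl := coords R A s *m toR R (A *m xo).
have dlE : dl = beta s b - toR R xs.
  rewrite /dl /beta -Ax [in RHS]xE !toR_mul.
  have -> : toR R (xo + xs) = toR R xo + toR R xs.
    by apply/matrixP => i j; rewrite !mxE rmorphD.
  rewrite !mulmxDr [coords R A s *m (Ar *m toR R xs)]coords_mul ?addrK // => i is_.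
  by rewrite !mxE (negbTE is_).
have dl0 i : 0 <= dl i 0.
  rewrite /dl toR_mul mulmxA mxE; apply: sumr_ge0 => j _.
  rewrite toRE [xo _ _]mxE.
  case: ifPn => js; first by rewrite mulr0.
  have [->|xj] := eqVneq (x j 0) 0; first by rewrite mulr0.
  rewrite mulr_ge0 ?ler0z ?x0 //; have := xK _ js xj i.
  by rewrite colE mulmxA -colE mxE.
have dl_frac i : i \in s -> beta s b i 0 - (flo s b i 0)%:~R <= dl i 0.
  move=> is_; have := dl0 i; rewrite dlE subrmxE toRE.
  rewrite [xs _ _]mxE is_ subr_ge0 => h; rewrite lerD2l lerN2 ler_int.
  by rewrite [flo _ _ _ _]mxE floor_ge_int.
have dlk : beta s b k 0 - (flo s b k 0)%:~R + 1 <= dl k 0.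
  rewrite dlE subrmxE toRE [xs _ _]mxE ks.
  have : ((x k 0)%:~R : R) <= -1 by rewrite -[-1]/((-1)%:~R) ler_int -ltzD1 addNr.
  have : 0 <= (flo s b k 0)%:~R :> R.
    by rewrite ler0z [flo _ _ _ _]mxE floor_ge_int; exact: sb.
  by lra.
have dl_out i : i \notin s -> dl i 0 = 0 by move=> is_; rewrite /dl coords_notin.
have beta_out i : i \notin s -> beta s b i 0 = 0.
  by move=> is_; rewrite /beta coords_notin.
have Fdl : frac_value s b + w 0 k <= \sum_i w 0 i * dl i 0.
  rewrite /frac_value (bigD1 k) //= [leRHS](bigD1 k) //= addrAC; apply: lerD.
    by rewrite -[X in _ + X]mulr1 -mulrDr ler_wpM2l // ltW.
  apply: ler_sum => i ik; apply: ler_wpM2l; first exact: ltW.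
  have [is_|is_] := boolP (i \in s); first exact: dl_frac.
  by rewrite dl_out // [flo _ _ _ _]mxE beta_out // floor0 subr0.
have dl_cost : (1 - th) * P * (\sum_i w 0 i * dl i 0)
    <= \sum_j slack A cr s 0 j * (x j 0)%:~R.
  rewrite -coords_price col_sum_price mulr_sumr; apply: ler_sum => j _.
  rewrite [xo _ _]mxE; case: ifPn => js.
    by rewrite !mulr0 slack_in // mul0r.
  have [->|xj] := eqVneq (x j 0) 0; first by rewrite !mulr0.
  rewrite mulrA ler_wpM2r ?ler0z ?x0 //.
  by case: (proj1 (c_adapted sM js) (xK _ js xj)).
have /andP[F0 FC] := frac_value_bounds s b.
have h1 := th_small k F0 FC.
have h2 : (1 - th) * P * (frac_value s b + w 0 k)
    <= (1 - th) * P * (\sum_i w 0 i * dl i 0).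
  by apply: ler_wpM2l; [apply: mulr_ge0; [rewrite subr_ge0 ltW|exact: ltW]|].
have h3 : P * ((1 + th) * frac_value s b) < P * ((1 - th) * (frac_value s b + w 0 k)).
  by rewrite ltr_pM2l.
by move: xc dl_cost h2 h3; lra.
Qed.

Context (e : R) (e1 : 1 <= e).
Context (e_large : forall s j, maximal_face D s -> in_simplex A s (col j Ar) ->
  1 <= e * ((1 - th) * value A w s (col j Ar))).
Context (W : nat).
Context (W_large : forall s i, 
  2 * C * e * (1 + \sum_j `|(coords R A s *m Ar) i j|) < W%:R).
Context (c_digits : forall v : 'cV[int]_n, (forall j, `|v j 0| < W%:Z) ->
      (c *m v) 0 0 = 0 -> v = 0).

Lemma cost_int x : cost cr x = ((c *m x) 0 0)%:~R.
Proof. by rewrite /cost /cr -toR_mul mxE. Qed.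

Lemma cheap_bound s b x j : maximal_face D s -> group_feasible s b x ->
  \sum_j slack A cr s 0 j * (x j 0)%:~R <= (1 + th) * P * frac_value s b ->
  j \notin s -> (x j 0)%:~R <= 2 * C * e.
Proof.
move=> sM fx xc js; have := cheap_entry j sM fx xc.
have := slack_adapted_gt sM js e1 (e_large sM).
have xj : 0 <= (x j 0)%:~R :> R by rewrite ler0z; case: fx => _; apply.
move=> h1 h2; rewrite -(ler_pM2l P0).
apply: (@le_trans _ _ (e * slack A cr s 0 j * (x j 0)%:~R)).
  exact: ler_wpM2r.
rewrite -mulrA; have -> : P * (2 * C * e) = e * (2 * C * P) by lra.
by apply: ler_wpM2l => //; move: e1; lra.
Qed.

(** The entries off [s] are bounded by [cheap_bound] and determine those on [s],
so the difference is small enough for [c_digits]. *)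
Lemma cheap_unique s b x x' : maximal_face D s ->
  group_feasible s b x -> group_feasible s b x' ->
  \sum_j slack A cr s 0 j * (x j 0)%:~R <= (1 + th) * P * frac_value s b ->
  \sum_j slack A cr s 0 j * (x' j 0)%:~R <= (1 + th) * P * frac_value s b ->
  cost cr x = cost cr x' -> x = x'.
Proof.
move=> sM fx fx' xc xc' cE; have bs := D_basis sM; have C0 := C_ge0.
apply/eqP; rewrite -subr_eq0; apply/eqP; pose v := x - x'.
have Ce : 0 <= 2 * C * e by rewrite !mulr_ge0 //; move: e1; lra.
have v_out j : j \notin s -> `|(v j 0)%:~R : R| <= 2 * C * e.
  move=> js; have h1 := cheap_bound sM fx xc js; have h2 := cheap_bound sM fx' xc' js.
  have h3 : 0 <= (x j 0)%:~R :> R by rewrite ler0z; case: fx => _; apply.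
  have h4 : 0 <= (x' j 0)%:~R :> R by rewrite ler0z; case: fx' => _; apply.
  by rewrite subrmxE intrB ler_norml; lra.
pose vo : 'cV[int]_n := \col_j (if j \in s then 0 else v j 0).
pose vs : 'cV[int]_n := \col_j (if j \in s then v j 0 else 0).
have vE : toR R v = toR R vo + toR R vs.
  apply/colP => j; rewrite !mxE -intrD; congr (_%:~R).
  by case: ifP; rewrite ?add0r ?addr0.
(* The entries on [s] are a fixed linear function of those off [s]. *)
have vsE : toR R vs = - (coords R A s *m Ar *m toR R vo).
  have Av : Ar *m toR R v = 0.
    rewrite -toR_mul mulmxBr (proj1 fx) (proj1 fx') subrr.
    by apply/matrixP => i j; rewrite !mxE.
  have : coords R A s *m (Ar *m toR R vs) = toR R vs.
    by apply: coords_mul => // i is_; rewrite !mxE (negbTE is_).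
  have -> : Ar *m toR R vs = - (Ar *m toR R vo).
    by apply/eqP; rewrite -addr_eq0 addrC -mulmxDr -vE Av.
  by rewrite mulmxN mulmxA.
apply: c_digits => [j|]; last first.
  rewrite mulmxBr subrmxE; apply/eqP; rewrite subr_eq0.
  by rewrite -(eqr_int R) -!cost_int cE.
rewrite -[_ - _]/v -(ltr_int R) intr_norm.
have S0 : 0 <= \sum_i `|(coords R A s *m Ar) j i| by apply: sumr_ge0.
apply: le_lt_trans (W_large s j).
have [js|js] := boolP (j \in s); last first.
  by apply: le_trans (v_out j js) _; rewrite ler_peMr //; lra.
have -> : (v j 0)%:~R = toR R vs j 0 by rewrite !mxE js.
rewrite vsE mxE normrN mxE; apply: le_trans (ler_norm_sum _ _ _) _.
rewrite mulrDr mulr1 ler_wpDl // mulr_sumr; apply: ler_sum => i _.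
rewrite normrM mulrC ler_wpM2r // toRE [vo _ _]mxE.
by case: ifPn => [_|/v_out //]; rewrite normr0.
Qed.

(** The cost takes integral values and is bounded below on the feasible points,
so an optimum exists. *)
Lemma relaxation_solved s b : maximal_face D s -> in_simplex A s (toR R b) ->
  exists2 x, unique (G_optimal A cr s b) x & x \is a mxOver Num.nneg.
Proof.
move=> sM sb; have bs := D_basis sM.
have [y [yb y0 yc]] := rounded_solution sM sb.
have fy : group_feasible s b y by split=> // j _; exact: (mxOverP y0).
have cE x : group_feasible s b x -> cost cr x =
    (cr *m coords R A s *m toR R b) 0 0 + \sum_j slack A cr s 0 j * (x j 0)%:~R.
  by move=> [<- _]; exact: cost_slack.
have cheap x : group_feasible s b x -> cost cr x <= cost cr y ->
    \sum_j slack A cr s 0 j * (x j 0)%:~R <= (1 + th) * P * frac_value s b.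
  by move=> fx; rewrite !cE // lerD2l => /le_trans; apply.
have [||z [x fx <-] xmin] := @int_set_min
  (fun z => exists2 x, group_feasible s b x & (c *m x) 0 0 = z)
  (Num.floor ((cr *m coords R A s *m toR R b) 0 0)).
- by exists ((c *m y) 0 0); exists y.
- move=> _ [x fx <-]; rewrite -(ler_int R) (le_trans (floor_le _)) //.
  by rewrite -cost_int cE // lerDl sumr_ge0 // => j _; exact: slack_term fx.
have xopt x' : group_feasible s b x' -> cost cr x <= cost cr x'.
  by move=> fx'; rewrite !cost_int ler_int; apply: xmin; exists x'.
exists x; last exact: cheap_nonneg sM sb fx (cheap _ fx (xopt _ fy)).
split; first by apply/G_optimalE.
move=> x' /(G_optimalE _ _ _ bs) [fx' x'opt].
apply: (cheap_unique sM fx fx' (cheap _ fx (xopt _ fy)) (cheap _ fx' (x'opt _ fy))).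
by apply/eqP; rewrite eq_le xopt // x'opt.
Qed.

End Relaxation.

(** The feasible points of the program are the nonnegative feasible points of
the relaxation. *)
Lemma relaxation_generic (R : realType) (d n : nat) (A : 'M[int]_(d, n))
    (c : 'rV[R]_n) :
  (forall s, maximal_face (Delta A c) s -> simplex_basis R A s) ->
  Gomory_family A c -> generic A c.
Proof.
move=> bD gom b /gom [s sM [x [xopt xuniq] x0]]; have bs := bD _ sM.
have [[Ax xs] xmin] := proj1 (G_optimalE c b x bs) xopt.
have feas x' : IP_feasible A b x' -> group_feasible A s b x'.
  by move=> [Ax' x'0]; split=> // j _; exact: (mxOverP x'0).
exists x; split; first by split=> // x' /feas; exact: xmin.
move=> x' [fx' x'min]; apply: xuniq; apply/(G_optimalE c b x' bs).
split; first exact: feas.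
by move=> x'' /xmin; apply: le_trans; apply: x'min.
Qed.

(** * Gomory families *)

Theorem theorem7p7 (R : realType) (d n : nat) (A : 'M[int]_(d, n))
  (rank_A : \rank (toR R A) = d)
  (pointed_A : pointed (cone (toR R A)))
  (ker_A : [set u : 'cV[R]_n | toR R A *m u = 0 /\ u \is a mxOver Num.nneg]
             = [set 0])
  (D : set {set 'I_n})
  (triang_D : regular_triangulation R A D)
  (normal_D : Delta_normal R A D) :
  exists c : 'rV[int]_n,
    [/\ generic A (toR R c), D = Delta A (toR R c)
      & Gomory_family A (toR R c)].
Proof.
have [c' gc' DE] := triang_D.
have [y y_pos] := positive_functional ker_A.
have D_basis s : maximal_face D s -> simplex_basis R A s.
  by rewrite DE; exact: maximal_face_basis.
have D_cover v : cone (toR R A) v ->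
    exists2 s, maximal_face D s & in_simplex A s v.
  by rewrite DE; apply: maximal_faces_cover => //; exact: Delta_nonempty y_pos.
have D_sub (s t : {set 'I_n}) : maximal_face D s -> t \subset s -> D t.
  by move=> sM; rewrite DE; apply: face_subset (D_basis _ sM) _; rewrite -DE; case: sM.
have c'_slack s : maximal_face D s -> forall j, j \notin s -> 0 < slack A c' s 0 j.
  move=> sM j; have [|yc ys] := face_priceE (c := c') (D_basis _ sM).
    by rewrite -DE; case: sM.
  by rewrite -{1}ys inE slackE subr_gt0 lt_neqAle yc andbT.
have [|M M0 MP] := @large_enough R 'I_n (fun j (M : R) =>
    0 < c' 0 j + M * (y *m toR R A) 0 j).
  move=> j; exists ((1 + `|c' 0 j|) / (y *m toR R A) 0 j) => M.
  rewrite ler_pdivrMr // => MM.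
  by have := ler_norm (- c' 0 j); rewrite normrN; lra.
pose w := c' - (- M) *: (y *m toR R A).
have w_pos j : 0 < w 0 j.
  rewrite /w scaleNr opprK; have := MP M j (lexx _).
  by move: (y *m _) => z; rewrite !mxE.
have w_slack s : maximal_face D s -> forall j, j \notin s -> 0 < slack A w s 0 j.
  move=> sM j js; rewrite slack_linear.
  have -> : slack A (y *m toR R A) s = 0.
    by rewrite /slack -(mulmxA y) coordsK ?mulmx1 ?subrr // D_basis.
  by rewrite [X in _ * X]mxE mulr0 subr0 c'_slack.
pose C : R := \sum_j w 0 j.
have C0 : 0 <= C by apply: sumr_ge0 => j _; exact: ltW.
have [|K K0 KP] := @large_enough R 'I_n (fun j (M : R) => 1 <= M * w 0 j).
  by move=> j; exists (w 0 j)^-1 => K; rewrite -ler_pdivrMr // div1r.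
pose m := K^-1; have m0 : 0 < m by rewrite invr_gt0.
have w_ge k : m <= w 0 k by rewrite /m -[K^-1]div1r ler_pdivrMr // mulrC KP.
(* With this [th] the margin [m] exceeds the relative error on costs up to [C]. *)
pose th := m / (2 * (m + C)).
have mC : 0 < 2 * (m + C) by lra.
have th0 : 0 < th by rewrite divr_gt0.
have thE : th * (2 * (m + C)) = m by rewrite /th divfK // gt_eqF.
have th1 : th < 1 by rewrite ltr_pdivrMr //; lra.
have th_small k (F : R) : 0 <= F -> F <= C -> (1 + th) * F < (1 - th) * (F + w 0 k).
  move=> F0 FC.
  have h1 : th * F <= th * C by rewrite ler_pM2l.
  have h2 : (1 - th) * m <= (1 - th) * w 0 k by rewrite ler_pM2l // subr_gt0.
  have h3 : 0 < th * m by rewrite mulr_gt0.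
  by move: thE h1 h2 h3; lra.
(* [e] converts costs into bounds on entries off [s]; [W] then bounds all entries of
   the difference of two optimal solutions, before [c] is chosen. *)
have [|E0 E00 EP] := @large_enough R ({set 'I_n} * 'I_n)%type (fun p (M : R) =>
    maximal_face D p.1 -> in_simplex A p.1 (col p.2 (toR R A)) ->
    1 <= M * ((1 - th) * value A w p.1 (col p.2 (toR R A)))).
  move=> [s j] /=; have [sM|] := pselect (maximal_face D s); last by exists 0.
  have [sj|] := pselect (in_simplex A s (col j (toR R A))); last by exists 0.
  have v0 : 0 < (1 - th) * value A w s (col j (toR R A)).
    by rewrite mulr_gt0 ?subr_gt0 //; exact: (value_col_gt0 D_basis w_pos ker_A sM sj).
  exists ((1 - th) * value A w s (col j (toR R A)))^-1 => M' M'M _ _.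
  by rewrite -ler_pdivrMr // div1r.
pose e := E0 + 1; have e1 : 1 <= e by rewrite /e; lra.
have e_large s j : maximal_face D s -> in_simplex A s (col j (toR R A)) ->
    1 <= e * ((1 - th) * value A w s (col j (toR R A))).
  by apply: (EP e (s, j)); rewrite /e; lra.
have [|W0 W00 WP] := @large_enough R ({set 'I_n} * 'I_n)%type (fun p (M : R) =>
    2 * C * e * (1 + \sum_j `|(coords R A p.1 *m toR R A) p.2 j|) < M).
  move=> p; exists (2 * C * e * (1 + \sum_j `|(coords R A p.1 *m toR R A) p.2 j|) + 1).
  by move=> M'; apply: lt_le_trans; rewrite ltrDl.
pose W := Num.Def.archi_bound W0.
have W0W : W0 < W%:R by rewrite archi_boundP // ltW.
have W_pos : (0 < W)%N by rewrite -(ltr_nat R) (lt_trans W00).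
have [P P0 [c c_adapted c_digits]] :=
  adapted_cost_exists D_basis D_cover w_pos w_slack ker_A (2 * C) th0 W_pos.
have c_slack s : maximal_face D s -> forall j, j \notin s ->
    0 < slack A (toR R c) s 0 j.
  move=> sM j js; have := slack_adapted_gt w_pos P0 c_adapted sM js e1 (e_large s j sM).
  move=> /(lt_le_trans P0); rewrite pmulr_rgt0 //; exact: lt_le_trans e1.
have cE : D = Delta A (toR R c) by exact: Delta_of_slack.
have gom : Gomory_family A (toR R c).
  move=> b [u u0 bE]; have [|s sM sb] := D_cover (toR R b).
    exists (toR R u); last by rewrite bE toR_mul.
    by apply/mxOverP => i j; rewrite toRE nnegrE ler0z; exact: (mxOverP u0).
  exists s; first by rewrite -cE.
  apply: (relaxation_solved D_basis w_pos normal_D th0 th1 P0 th_small c_adapted e1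
            e_large _ c_digits sM sb) => t i.
  by apply: lt_trans W0W; exact: (WP W0 (t, i)).
exists c; split=> //; apply: relaxation_generic gom => s; rewrite -cE; exact: D_basis.
Qed.
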